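(* If $Q$ and $S$ are profinite quandles, then the disjoint union $Q\sqcup S$ is a profinite quandle.
   Context: A quandle $(Q,\triangleleft,\triangleleft^{-1})$ is a set with two binary operations such that for all $x,y,z$: $x\triangleleft x=x$; $(x\triangleleft y)\triangleleft^{-1}y=x=(x\triangleleft^{-1}y)\triangleleft y$; $(x\triangleleft y)\triangleleft z=(x\triangleleft z)\triangleleft(y\triangleleft z)$. A quandle homomorphism is a map preserving $\triangleleft$. The disjoint union quandle $Q\sqcup S$ of quandles $(Q,\triangleleft_Q)$ and $(S,\triangleleft_S)$ is the disjoint union of the underlying sets with the operation: $q\triangleleft s=q$ and $s\triangleleft q=s$ for $q\in Q$, $s\in S$; $q_1\triangleleft q_2=q_1\triangleleft_Q q_2$ for $q_1,q_2\in Q$; $s_1\triangleleft s_2=s_1\triangleleft_S s_2$ for $s_1,s_2\in S$. A directed poset is a partially ordered set in which every pair of elements has an upper bound. An inverse system of quandles over a directed poset $\Lambda$ consists of quandles $Q_\lambda$ and quandle homomorphisms $\varphi_{\alpha\beta}:Q_\beta\to Q_\alpha$ ($\alpha\leq\beta$) with $\varphi_{\alpha\alpha}=\mathrm{id}$ and $\varphi_{\alpha\delta}=\varphi_{\alpha\beta}\circ\varphi_{\beta\delta}$ for $\alpha\le\beta\le\delta$. Its inverse limit is the set of $(q_\lambda)\in\prod Q_\lambda$ with $q_\alpha=\varphi_{\alpha\beta}(q_\beta)$ for all $\alpha\leq\beta$, with coordinatewise operations. A quandle is profinite if it is (isomorphic to) the inverse limit of an inverse system of finite quandles and quandle homomorphisms.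 *)

(* Defs.v *)
From HB Require Import structures.
From mathcomp Require Import all_boot all_order.
From mathcomp Require Import boolp classical_sets functions cardinality.

Set Implicit Arguments.
Unset Strict Implicit.
Unset Printing Implicit Defensive.

Local Open Scope order_scope.

Reserved Notation "x ◁ y" (at level 40, left associativity).
Reserved Notation "x ◁⁻¹ y" (at level 40, left associativity).

HB.mixin Record isQuandle T := {
  qop : T -> T -> T;
  qopV : T -> T -> T;
  qop_idem : forall x, qop x x = x;
  qopK : forall x y, qopV (qop x y) y = x;
  qopVK : forall x y, qop (qopV x y) y = x;
  qop_distr : forall x y z, qop (qop x y) z = qop (qop x z) (qop y z)
}.

#[short(type="quandleType")]
HB.structure Definition Quandle := {T of isQuandle T}.

Notation "x ◁ y" := (qop x y).
Notation "x ◁⁻¹ y" := (qopV x y).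

Definition quandle_hom (Q S : quandleType) (f : Q -> S) : Prop :=
  {morph f : x y / x ◁ y}.

Definition quandle_isomorphic (Q S : quandleType) : Prop :=
  exists2 f : Q -> S, quandle_hom f & bijective f.

Section DisjointUnion.
Variables Q S : quandleType.

Definition sum_qop (x y : Q + S) : Q + S :=
  match x, y with
  | inl q1, inl q2 => inl (q1 ◁ q2)
  | inr s1, inr s2 => inr (s1 ◁ s2)
  | _, _ => x
  end.

Definition sum_qopV (x y : Q + S) : Q + S :=
  match x, y with
  | inl q1, inl q2 => inl (q1 ◁⁻¹ q2)
  | inr s1, inr s2 => inr (s1 ◁⁻¹ s2)
  | _, _ => x
  end.

Fact sum_qop_idem x : sum_qop x x = x.
Proof. by case: x => x /=; rewrite qop_idem. Qed.

Fact sum_qopK x y : sum_qopV (sum_qop x y) y = x.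
Proof. by case: x y => x [] y //=; rewrite qopK. Qed.

Fact sum_qopVK x y : sum_qop (sum_qopV x y) y = x.
Proof. by case: x y => x [] y //=; rewrite qopVK. Qed.

Fact sum_qop_distr x y z :
  sum_qop (sum_qop x y) z = sum_qop (sum_qop x z) (sum_qop y z).
Proof. by case: x y z => x [] y [] z //=; rewrite qop_distr. Qed.

HB.instance Definition _ := isQuandle.Build (Q + S)%type
  sum_qop_idem sum_qopK sum_qopVK sum_qop_distr.

End DisjointUnion.

Definition directed_order d (L : porderType d) : Prop :=
  forall a b : L, exists c : L, a <= c /\ b <= c.

Record inverse_system d (L : porderType d) := InverseSystem {
  inv_obj :> L -> quandleType;
  inv_map : forall a b : L, a <= b -> inv_obj b -> inv_obj a;
  inv_map_hom : forall (a b : L) (ab : a <= b), quandle_hom (inv_map ab);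
  inv_map_id : forall (a : L) (aa : a <= a) (x : inv_obj a),
    inv_map aa x = x;
  inv_map_comp : forall (a b c : L) (ab : a <= b) (bc : b <= c) (ac : a <= c)
    (x : inv_obj c), inv_map ac x = inv_map ab (inv_map bc x)
}.

Section InverseLimit.
Variables (d : Order.disp_t) (L : porderType d) (X : inverse_system L).

Definition compatible (x : forall l, X l) : Prop :=
  forall (a b : L) (ab : a <= b), x a = inv_map ab (x b).

Definition inverse_limit : Type := {x : forall l, X l | compatible x}.

Implicit Types x y z : inverse_limit.

Fact inverse_limit_inj x y : (forall l, sval x l = sval y l) -> x = y.
Proof.
case: x y => [x cx] [y cy] /= xy; apply: eq_exist.
exact: functional_extensionality_dep.
Qed.

Fact lim_qop_compatible x y : compatible (fun l => sval x l ◁ sval y l).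
Proof.
by move=> a b ab; rewrite inv_map_hom -(proj2_sig x) -(proj2_sig y).
Qed.

Fact lim_qopV_compatible x y : compatible (fun l => sval x l ◁⁻¹ sval y l).
Proof.
move=> a b ab; rewrite (proj2_sig x _ _ ab) (proj2_sig y _ _ ab).
by rewrite -{1}[sval x b](@qopVK _ _ (sval y b)) inv_map_hom qopK.
Qed.

Definition lim_qop x y : inverse_limit := exist _ _ (lim_qop_compatible x y).
Definition lim_qopV x y : inverse_limit := exist _ _ (lim_qopV_compatible x y).

Fact lim_qop_idem x : lim_qop x x = x.
Proof. by apply: inverse_limit_inj => l /=; rewrite qop_idem. Qed.

Fact lim_qopK x y : lim_qopV (lim_qop x y) y = x.
Proof. by apply: inverse_limit_inj => l /=; rewrite qopK. Qed.

Fact lim_qopVK x y : lim_qop (lim_qopV x y) y = x.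
Proof. by apply: inverse_limit_inj => l /=; rewrite qopVK. Qed.

Fact lim_qop_distr x y z :
  lim_qop (lim_qop x y) z = lim_qop (lim_qop x z) (lim_qop y z).
Proof. by apply: inverse_limit_inj => l /=; rewrite qop_distr. Qed.

HB.instance Definition _ := isQuandle.Build inverse_limit
  lim_qop_idem lim_qopK lim_qopVK lim_qop_distr.

End InverseLimit.

(* The order is not required to be inhabited; the limit over an empty order is
   the one-point quandle, which is also the limit of a one-object system. *)
Definition profinite (Q : quandleType) : Prop :=
  exists (d : Order.disp_t) (L : porderType d) (X : inverse_system L),
    [/\ directed_order L,
        forall l, finite_set [set: X l]
      & quandle_isomorphic Q (inverse_limit X)].

(* Main.v *)
(** Index the sums [X l ⊔ Y m] of two inverse systems by pairs [(l, m)]. The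
    transition maps preserve the two summands, so by directedness a compatible
    family lies entirely in one of them, say the first; again by directedness
    its [(l, m)] entry does not depend on [m], so the family comes from a point
    of [lim X]. This needs nonempty index sets, which can be arranged: over an
    empty order the limit is a point. *)
Require Import Defs.
From HB Require Import structures.
From mathcomp Require Import all_boot all_order.
From mathcomp Require Import boolp classical_sets functions cardinality.

Set Implicit Arguments.
Unset Strict Implicit.
Unset Printing Implicit Defensive.

Import Order.TTheory.
Local Open Scope order_scope.

(** The one-point quandle, from which the system replacing one over an empty order is built. *)
HB.instance Definition _ := isQuandle.Build unit
  (qop := fun _ _ => tt) (qopV := fun _ _ => tt)
  (fun x => let: tt := x in erefl) (fun x _ => let: tt := x in erefl)
  (fun x _ => let: tt := x in erefl) (fun _ _ _ => erefl).

Section ConstantSystem.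
Variables (d : Order.disp_t) (L : porderType d) (Q : quandleType).

Definition constant_system : inverse_system L :=
  @InverseSystem d L (fun _ => Q) (fun _ _ _ x => x)
    (fun _ _ _ _ _ => erefl) (fun _ _ _ => erefl) (fun _ _ _ _ _ _ _ => erefl).

End ConstantSystem.

Lemma bijectiveP (T U : Type) (f : T -> U) :
  injective f -> (forall y, exists x, f x = y) -> bijective f.
Proof.
move=> injf /choice[g gK]; exists g => // x.
by apply: injf; rewrite gK.
Qed.

(** Over an empty order the limit is a single point, and so is the limit of the constant system
    [unit] over [nat]; any other inhabited directed order would serve as well as [nat]. *)
Lemma profinite_inhabited (Q : quandleType) : profinite Q ->
  exists (d : Order.disp_t) (L : porderType d) (X : inverse_system L),
    [/\ inhabited L, directed_order L, forall l, finite_set [set: X l]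
      & quandle_isomorphic Q (inverse_limit X)].
Proof.
move=> [d [L [X [dirL finX [f fM bijf]]]]].
have [inhL|emptyL] := pselect (inhabited L).
  by exists d, L, X; split=> //; exists f.
exists _, nat, (constant_system nat unit).
split=> [|a b|l|].
- exact: inhabits 0%N.
- by exists (Order.max a b); rewrite !le_max !lexx orbT.
- exact: (@finite_finset unit).
- have limP (x y : inverse_limit X) : x = y.
    by apply: inverse_limit_inj => l; case: emptyL; split.
  have limuP (x y : inverse_limit (constant_system nat unit)) : x = y.
    by apply: inverse_limit_inj => l; case: (sval x l) (sval y l) => [] [].
  have tt_compatible : @compatible _ _ (constant_system nat unit) (fun=> tt).
    by [].
  (* The empty family: it shows that the limit over the empty order has a point, whose preimage in
     [Q] gives surjectivity below. *)
  have pt_compatible : compatible (fun l => match emptyL (inhabits l) return X l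
    with end) by move=> a; case: emptyL; split.
  have [g gK fK] := bijf.
  exists (fun=> exist _ _ tt_compatible) => [x y|]; first exact: limuP.
  apply: bijectiveP => [x y _|y].
    by apply: (can_inj gK); apply: limP.
  by exists (g (exist _ _ pt_compatible)); apply: limuP.
Qed.

Definition sum_map (A B C D : Type) (f : A -> B) (g : C -> D) (x : A + C) :=
  match x with inl a => inl (f a) | inr c => inr (g c) end.

Section SumSystem.
Variables (d d' : Order.disp_t) (L : porderType d) (M : porderType d').
Variables (X : inverse_system L) (Y : inverse_system M).

Let LM : porderType _ := (L *p M)%type.

Fact prod_le1 (a b : LM) : a <= b -> a.1 <= b.1.
Proof. by rewrite leEprod => /andP[]. Qed.

Fact prod_le2 (a b : LM) : a <= b -> a.2 <= b.2.
Proof. by rewrite leEprod => /andP[]. Qed.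

Definition sum_inv_obj (a : LM) : quandleType := (X a.1 + Y a.2)%type.

Definition sum_inv_map (a b : LM) (ab : a <= b) :
    sum_inv_obj b -> sum_inv_obj a :=
  sum_map (inv_map (prod_le1 ab)) (inv_map (prod_le2 ab)).

Fact sum_inv_map_hom a b (ab : a <= b) : quandle_hom (sum_inv_map ab).
Proof. by move=> [x|x] [y|y] //=; congr (_ _); exact: inv_map_hom. Qed.

Fact sum_inv_map_id a (aa : a <= a) x : sum_inv_map aa x = x.
Proof. by case: x => x /=; rewrite inv_map_id. Qed.

Fact sum_inv_map_comp a b c (ab : a <= b) (bc : b <= c) (ac : a <= c) x :
  sum_inv_map ac x = sum_inv_map ab (sum_inv_map bc x).
Proof. by case: x => x /=; congr (_ _); exact: inv_map_comp. Qed.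

Definition sum_system : inverse_system LM :=
  InverseSystem sum_inv_map_hom sum_inv_map_id sum_inv_map_comp.

Lemma directed_prod : directed_order L -> directed_order M -> directed_order LM.
Proof.
move=> dirL dirM a b.
have [l [al bl]] := dirL a.1 b.1; have [m [am bm]] := dirM a.2 b.2.
by exists (l, m); rewrite !leEprod /= al bl am bm.
Qed.

Lemma finite_sum_system :
  (forall l, finite_set [set: X l]) -> (forall m, finite_set [set: Y m]) ->
  forall a, finite_set [set: sum_system a].
Proof.
move=> finX finY a.
apply: (@sub_finite_set _ _
  ((inl @` [set: X a.1]) `|` (inr @` [set: Y a.2]))%classic).
  by move=> [x|y] _; [left; exists x|right; exists y].
by rewrite finite_setU; split; apply: finite_image.
Qed.

Fact sum_limit_compatible (u : inverse_limit X + inverse_limit Y) :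
  @compatible _ _ sum_system (fun a =>
    match u with inl x => inl (sval x a.1) | inr y => inr (sval y a.2) end).
Proof. by case: u => u a b ab /=; congr (_ _); exact: (proj2_sig u). Qed.

(** The comparison map from the sum of the limits to the limit of the sums, bijective once both
    orders are inhabited and directed. *)
Definition sum_limit (u : inverse_limit X + inverse_limit Y) :
  inverse_limit sum_system := exist _ _ (sum_limit_compatible u).

Lemma sum_limit_hom : quandle_hom sum_limit.
Proof. by move=> [x|x] [y|y]; apply: inverse_limit_inj. Qed.

(** The entry at [(l0, m0)] reveals the summand; the entries at [(l, m0)], or at [(l0, m)], then
    recover every coordinate of the point. *)
Lemma sum_limit_inj : inhabited L -> inhabited M -> injective sum_limit.
Proof.
move=> [l0] [m0] u v /(congr1 sval) uv.
have {}uv a : sval (sum_limit u) a = sval (sum_limit v) a by rewrite uv.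
case: u v uv => u [] v uv /=; have:= uv (l0, m0) => //= _; congr (_ _).
  by apply: inverse_limit_inj => l; have [] := uv (l, m0).
by apply: inverse_limit_inj => m; have [] := uv (l0, m).
Qed.

Lemma sum_limit_surj : inhabited L -> inhabited M ->
  directed_order L -> directed_order M -> forall z, exists u, sum_limit u = z.
Proof.
move=> [l0] [m0] dirL dirM [z zP].
have dirLM := directed_prod dirL dirM.
case z0 : (z (l0, m0)) => [x0|y0].
(* Both [z a] and [z (l0, m0)] are images of [z c] for a common upper bound [c], and transition maps
   never change the summand. *)
- have zl a : exists x, z a = inl x.
    have [c [ac c0]] := dirLM a (l0, m0).
    move: z0; rewrite (zP _ _ c0) (zP _ _ ac).
    by case: (z c) => //= x _; eexists.
  pose x l := projT1 (cid (zl (l, m0))).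
  have zx a : z a = inl (x a.1).
    case: a => l m; rewrite /x; case: cid => /= x1 zx1.
    (* The entries at [(l, m)] and [(l, m0)] both come from [(l, m')], along maps that are the
       identity on the summand [X l]. *)
    have [m' [mm' m0m']] := dirM m m0.
    have le1 : ((l, m) : LM) <= (l, m') by rewrite leEprod /= lexx.
    have le2 : ((l, m0) : LM) <= (l, m') by rewrite leEprod /= lexx.
    move: zx1; rewrite (zP _ _ le1) (zP _ _ le2) /=.
    by case: (z (l, m')) => //= t; rewrite !inv_map_id => -[->].
  have xP : compatible x.
    move=> a b ab.
    have le : ((a, m0) : LM) <= (b, m0) by rewrite leEprod /= ab lexx.
    have := zP _ _ le; rewrite !zx /= => -[->].
    (* The two transition maps differ only in their proofs of [a <= b]. *)
    by congr (inv_map _ _); exact: bool_irrelevance.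
  by exists (inl (exist _ x xP)); apply: inverse_limit_inj => a /=; rewrite zx.
(* The mirror case: the first index is now frozen at [l0], and directedness of [L] removes the
   dependence on it. *)
- have zr a : exists y, z a = inr y.
    have [c [ac c0]] := dirLM a (l0, m0).
    move: z0; rewrite (zP _ _ c0) (zP _ _ ac).
    by case: (z c) => //= y _; eexists.
  pose y m := projT1 (cid (zr (l0, m))).
  have zy a : z a = inr (y a.2).
    case: a => l m; rewrite /y; case: cid => /= y1 zy1.
    have [l' [ll' l0l']] := dirL l l0.
    have le1 : ((l, m) : LM) <= (l', m) by rewrite leEprod /= lexx andbT.
    have le2 : ((l0, m) : LM) <= (l', m) by rewrite leEprod /= lexx andbT.
    move: zy1; rewrite (zP _ _ le1) (zP _ _ le2) /=.
    by case: (z (l', m)) => //= t; rewrite !inv_map_id => -[->].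
  have yP : compatible y.
    move=> a b ab.
    have le : ((l0, a) : LM) <= (l0, b) by rewrite leEprod /= ab lexx.
    have := zP _ _ le; rewrite !zy /= => -[->].
    by congr (inv_map _ _); exact: bool_irrelevance.
  by exists (inr (exist _ y yP)); apply: inverse_limit_inj => a /=; rewrite zy.
Qed.

End SumSystem.

Theorem proposition3p20 (Q S : quandleType)
    (profQ : profinite Q) (profS : profinite S) :
  profinite (Q + S)%type.
Proof.
have [d [L [X [inhL dirL finX [f fM bijf]]]]] := profinite_inhabited profQ.
have [d' [M [Y [inhM dirM finY [g gM bijg]]]]] := profinite_inhabited profS.
exists _, (L *p M)%type, (sum_system X Y); split.
- exact: directed_prod.
- exact: finite_sum_system.
(* First the two given isomorphisms, summand by summand, then the comparison map. *)
exists (@sum_limit _ _ _ _ X Y \o sum_map f g).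
  move=> u v /=; rewrite -sum_limit_hom; congr sum_limit.
  by case: u v => u [] v //=; rewrite ?fM ?gM.
apply: bij_comp.
  by apply: bijectiveP; [exact: sum_limit_inj|exact: sum_limit_surj].
have [f' fK f'K] := bijf; have [g' gK g'K] := bijg.
by exists (sum_map f' g') => -[] u /=; rewrite ?fK ?gK ?f'K ?g'K.
Qed.
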